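(* For $t\in\mathbb{R}$ let $\Phi_t\colon \mathrm{Sym}_3\to \mathrm{Sym}_3$ be the linear map sending the symmetric matrix $Z=[z_{ij}]_{i,j=0}^{2}$ to the symmetric matrix $$\Phi_t(Z)=\begin{bmatrix}(t^2-1)^2 z_{00}+z_{11}+t^4 z_{22}&-(t^4-t^2+1)z_{01}&-(t^4-t^2+1) z_{02} \\ -(t^4-t^2+1)z_{01}& t^4 z_{00}+(t^2-1)^2 z_{11}+z_{22} &-(t^4-t^2+1) z_{12}\\ -(t^4-t^2+1) z_{02}&-(t^4-t^2+1) z_{12} & z_{00}+t^4 z_{11}+ (t^2-1)^2 z_{22}\end{bmatrix}.$$ Then $\Phi_t$ is positive for every $t\in\mathbb{R}$. Moreover, for every $t\in\mathbb{R}\setminus\{1,-1\}$ the map $\Phi_t$ is extremal and is not completely positive.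
   Context: $\mathrm{Sym}_3$ is the space of real symmetric $3\times 3$ matrices; rows and columns are indexed by $0,1,2$. A linear map $\Phi\colon \mathrm{Sym}_3\to \mathrm{Sym}_3$ is positive if it maps positive semidefinite matrices to positive semidefinite matrices. It is completely positive if there exist $l\in\mathbb{N}$ and real $3\times 3$ matrices $B_1,\dots,B_l$ with $\Phi(xx^T)=\sum_{i=1}^l B_i xx^T B_i^T$ for all $x\in\mathbb{R}^3$; equivalently, the biquadratic form $y^T\Phi(xx^T)y$ in $x,y\in\mathbb{R}^3$ is a sum of squares of bilinear forms. A positive map on $\mathrm{Sym}_3$ is extremal if it cannot be written as a sum of two linearly independent positive maps $\mathrm{Sym}_3\to\mathrm{Sym}_3$. *)

(* Defs.v *)
From HB Require Import structures.
From mathcomp Require Import all_boot all_order all_algebra.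
From mathcomp Require Import reals.
From mathcomp Require Import ring.

Set Implicit Arguments.
Unset Strict Implicit.
Unset Printing Implicit Defensive.

Import Order.TTheory GRing.Theory Num.Theory.
Local Open Scope ring_scope.

Definition symv (R : realType) : {vspace 'M[R]_3} := fixedSpace (linfun trmx).

Lemma mem_symv (R : realType) (A : 'M[R]_3) : (A \in symv R) = (A^T == A).
Proof. by apply/fixedSpaceP/eqP; rewrite lfunE. Qed.

(* Elements of Sym3 R coerce to 3 x 3 matrices through vsval, and linear maps
   Sym_3 -> Sym_3 are the elements of 'End(Sym3 R). *)
Definition Sym3 (R : realType) := subvs_of (symv R).

Definition psd (R : realType) (A : 'M[R]_3) : Prop :=
  forall x : 'cV[R]_3, 0 <= (x^T *m A *m x) 0 0.

Fact outer_subproof (R : realType) (x : 'cV[R]_3) : x *m x^T \in symv R.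
Proof. by rewrite mem_symv trmx_mul trmxK. Qed.

Definition outer (R : realType) (x : 'cV[R]_3) : Sym3 R :=
  Subvs (outer_subproof x).

Definition positive_map (R : realType) (F : 'End(Sym3 R)) : Prop :=
  forall Z : Sym3 R, psd (vsval Z) -> psd (vsval (F Z)).

Definition completely_positive (R : realType) (F : 'End(Sym3 R)) : Prop :=
  exists (l : nat) (B : 'I_l -> 'M[R]_3), forall x : 'cV[R]_3,
    vsval (F (outer x)) = \sum_(i < l) B i *m (x *m x^T) *m (B i)^T.

Definition extremal (R : realType) (F : 'End(Sym3 R)) : Prop :=
  positive_map F /\
  ~ (exists F1 F2 : 'End(Sym3 R),
       [/\ positive_map F1, positive_map F2, free [:: F1; F2] & F = F1 + F2]).

Definition Phi_mx (R : realType) (t : R) (z : 'M[R]_3) : 'M[R]_3 :=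
  let a := (t ^+ 2 - 1) ^+ 2 in
  let c := t ^+ 4 in
  let d := t ^+ 4 - t ^+ 2 + 1 in
  \matrix_(i < 3, j < 3) nth 0 (nth [::]
    [:: [:: a * z 0 0 + z 1 1 + c * z 2 2; - d * z 0 1; - d * z 0 2];
        [:: - d * z 0 1; c * z 0 0 + a * z 1 1 + z 2 2; - d * z 1 2];
        [:: - d * z 0 2; - d * z 1 2; z 0 0 + c * z 1 1 + a * z 2 2]] i) j.

Fact Phi_subproof (R : realType) (t : R) (Z : Sym3 R) :
  Phi_mx t (vsval Z) \in symv R.
Proof.
rewrite mem_symv; apply/eqP/matrixP => i j; rewrite !mxE.
by case: i j => [[|[|[|i]]] // ?] [[|[|[|j]]] // ?].
Qed.

Definition Phi_fun (R : realType) (t : R) (Z : Sym3 R) : Sym3 R :=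
  Subvs (Phi_subproof t Z).

Fact Phi_fun_linear (R : realType) (t : R) : linear (@Phi_fun R t).
Proof.
have vsvalP k Y Z : vsval (k *: Y + Z : Sym3 R) = k *: vsval Y + vsval Z.
  exact: (linearP (@vsval R _ (symv R))).
move=> k Y Z; apply/val_inj; rewrite [RHS]vsvalP.
rewrite [LHS](_ : _ = Phi_mx t (k *: vsval Y + vsval Z)); last first.
  by rewrite -vsvalP.
apply/matrixP => i j; rewrite !mxE.
by case: i j => [[|[|[|i]]] // ?] [[|[|[|j]]] // ?] /=; ring.
Qed.

HB.instance Definition _ (R : realType) (t : R) :=
  GRing.isLinear.Build R (Sym3 R) (Sym3 R) *:%R (@Phi_fun R t)
    (@Phi_fun_linear R t).

Definition Phi (R : realType) (t : R) : 'End(Sym3 R) := linfun (Phi_fun t).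

Lemma PhiE (R : realType) (t : R) (Z : Sym3 R) :
  vsval (Phi t Z) = Phi_mx t (vsval Z).
Proof. by rewrite lfunE. Qed.

(* Main.v *)
Require Import Defs.
From mathcomp Require Import all_boot all_order all_algebra.
From mathcomp Require Import reals.
From mathcomp Require Import ring lra.

Set Implicit Arguments.
Unset Strict Implicit.
Unset Printing Implicit Defensive.

Import Order.TTheory GRing.Theory Num.Theory.
Local Open Scope ring_scope.

(** Write s = t^2, a = (s-1)^2, d = s^2-s+1.  Everything is about the
    biquadratic form p(x,y) = y^T Phi_t(x x^T) y, called [choi_form].

    Positivity.  A positive semidefinite matrix is a nonnegative combination of
    matrices x x^T ([psd_sum]), so positivity of a map is nonnegativity of its
    biquadratic form ([positive_mapP]).  For fixed x, the matrix Phi_t(x x^T) is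
    a diagonal matrix minus d x x^T; Lagrange's identity
    ([diag_sub_rank1_ge0]) reduces its semidefiniteness to nonnegativity of its
    determinant.  That determinant is a times a cyclic cubic in the x_i^2.
    The cubic vanishes to second order at (1,1,1), and expanding it around
    (w,w,w), with w the smallest variable, exhibits it as a sum of nonnegative
    terms ([choi_cubic_ge0]).

    Extremality.  Let 0 <= g <= p for a biquadratic form g; the claim is that g
    is a multiple of p.  At a zero of p both g and its gradient vanish, which
    gives linear equations on the coefficients of g.  The zeros are
    x = y = (+-1,+-1,+-1) and x = e_i + s e_j, y = s e_i + e_j for s = +-t,
    (i,j) in the cyclic order.  For t = 0 the latter degenerate and first-order
    conditions no longer suffice.  The remedy, uniform in t, is to use the whole
    curve x = e_i + s e_j, y = s e_i + e_j with s free, on which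
    p = (s^2 - t^2)^2.  With g(x,x;y,z) the polarized form, Cauchy-Schwarz gives
    g(x,x;y,z)^2 <= C (1 + s^2) (s^2 - t^2)^2 for every direction z, so the
    cubic polynomial s |-> g(x,x;y,z) is divisible by s^2 - t^2
    ([divisible_of_sqr_le], [face_zero_eqs]).  The equations split according to
    the characters of the sign changes (x,y) |-> (eps x, eps y): the invariant
    part forces the coefficients of g to be those of c p
    ([diagonal_sector]), the other parts force the remaining
    coefficients to vanish ([offdiagonal_sector]); t^2 <> 1 enters there.

    Failure of complete positivity.  If p is a sum of squares of bilinear forms
    y^T B x, then on the same curves (y^T B x)^2 <= (s^2 - t^2)^2, so that the
    linear coefficient B_ii + B_jj vanishes.  For three indices this makes the
    diagonal of B zero, although the coefficient a of x_0^2 y_0^2 in p is the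
    sum of the B_00^2. *)

(** * Two facts on real polynomials *)

Section Scalar.
Variable R : realFieldType.
Implicit Types (a b c s t x y z : R).

Lemma discriminant_le a b c : 0 <= c ->
  (forall z, 0 <= a + 2 * z * b + z ^+ 2 * c) -> b ^+ 2 <= a * c.
Proof.
move=> c0 h; have [c00|cn0] := eqVneq c 0.
  have [->|bn0] := eqVneq b 0; first by rewrite c00; lra.
  (* with c = 0 the affine function takes the value -1 here *)
  have := h (- (a + 1) / (2 * b)).
  rewrite (_ : _ + _ = - 1) ?c00 //; first lra.
  by field.
have cp : 0 < c by rewrite lt_def cn0.
have := h (- b / c).
rewrite (_ : _ + _ = (a * c - b ^+ 2) / c); last by field.
by rewrite pmulr_lge0 ?invr_gt0 // subr_ge0.
Qed.

(** A polynomial bounded by C (1 + |s|) |s^2 - t^2| is divisible by s^2 - t^2;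
    for a cubic, divisibility is the two equations below.  When t = 0 the double
    root is not visible from the value at 0, and the linear coefficient is
    killed by letting s tend to 0. *)
Lemma divisible_of_sqr_le t C w0 w1 w2 w3 : 0 <= C ->
  (forall s, (w0 + w1 * s + w2 * s ^+ 2 + w3 * s ^+ 3) ^+ 2
             <= C * (1 + s ^+ 2) * (s ^+ 2 - t ^+ 2) ^+ 2) ->
  w0 + t ^+ 2 * w2 = 0 /\ w1 + t ^+ 2 * w3 = 0.
Proof.
move=> C0 h.
have root0 s : s ^+ 2 = t ^+ 2 -> w0 + w1 * s + w2 * s ^+ 2 + w3 * s ^+ 3 = 0.
  move=> st; apply/eqP; rewrite -sqrf_eq0 eq_le sqr_ge0 andbT.
  by apply: le_trans (h s) _; rewrite st subrr expr0n mulr0.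
have [t0|tn0] := eqVneq t 0; last first.
  have hp := root0 t erefl; have hm := root0 (- t) (sqrrN t).
  have e1 : w0 + t ^+ 2 * w2 = 0 by move: hp hm; rewrite sqrrN !exprS; lra.
  split=> //; apply: (mulfI tn0); rewrite mulr0 -hp -[RHS]subr0 -e1; ring.
rewrite t0 in h root0 *.
have w00 : w0 = 0 by have := root0 0 erefl; lra.
suff w10 : w1 = 0 by rewrite w00 w10; split; ring.
have quot s : 0 < s -> s <= 1 -> `|w1| <= s * (2 * (C + 1) + `|w2| + `|w3|).
  move=> s0 s1.
  have q : (w1 + w2 * s + w3 * s ^+ 2) ^+ 2 <= (s * (2 * (C + 1))) ^+ 2.
    have s2 : s ^+ 2 <= 1 by rewrite expr_le1 // ltW.
    apply: (@le_trans _ _ (C * (1 + s ^+ 2) * s ^+ 2)); last first.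
      rewrite exprMn [leRHS]mulrC ler_wpM2r ?sqr_ge0 //.
      have : C * (1 + s ^+ 2) <= C * 2 by rewrite ler_wpM2l //; lra.
      by nra.
    rewrite -(@ler_pM2l _ (s ^+ 2)) ?exprn_gt0 //.
    have := h s; rewrite w00; congr (_ <= _); ring.
  have {}q : `|w1 + w2 * s + w3 * s ^+ 2| <= s * (2 * (C + 1)).
    by rewrite -ler_sqr ?nnegrE ?real_normK ?num_real //; nra.
  rewrite (_ : w1 = w1 + w2 * s + w3 * s ^+ 2 - w2 * s - w3 * s ^+ 2); last ring.
  apply: (le_trans (ler_normB _ _)).
  have : `|w3 * s ^+ 2| <= s * `|w3|.
    rewrite normrM mulrC ler_wpM2r // ger0_norm ?sqr_ge0 //; nra.
  have : `|w1 + w2 * s + w3 * s ^+ 2 - w2 * s| <= s * (2 * (C + 1)) + s * `|w2|.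
    apply: (le_trans (ler_normB _ _)).
    by rewrite lerD // normrM (gtr0_norm s0) mulrC.
  by rewrite !mulrDr; lra.
apply/eqP; rewrite -normr_le0 leNgt; apply/negP => wp.
set L := 2 * (C + 1) + `|w2| + `|w3| in quot.
have Lp : 0 < L by have := normr_ge0 w2; have := normr_ge0 w3; rewrite /L; lra.
have dp : 0 < `|w1| + L by lra.
(* any s <= 1 with s L < |w1| gives a contradiction *)
have := quot (`|w1| / (`|w1| + L)).
rewrite divr_gt0 // ler_pdivrMr // mul1r => /(_ isT).
rewrite mulrAC ler_pdivlMr //; nra.
Qed.

End Scalar.

(** * Polarized biquadratic forms *)

(** The polarization of a biquadratic form, as a function symmetric and linear
    in the first two and in the last two arguments.  Symmetry makes linearity in
    the first and third arguments enough. *)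
Record polarized (R : realFieldType) (V : lmodType R)
    (b : V -> V -> V -> V -> R) : Prop := Polarized {
  polDl : forall u u' v w z, b (u + u') v w z = b u v w z + b u' v w z;
  polZl : forall c u v w z, b (c *: u) v w z = c * b u v w z;
  polCl : forall u v w z, b u v w z = b v u w z;
  polDr : forall u v w w' z, b u v (w + w') z = b u v w z + b u v w' z;
  polZr : forall c u v w z, b u v (c *: w) z = c * b u v w z;
  polCr : forall u v w z, b u v w z = b u v z w
}.

Section Polarized.
Variables (R : realFieldType) (V : lmodType R).
Implicit Types (b : V -> V -> V -> V -> R) (u v w z : V) (s t : R).

(** Exchanging the roles of x and y: it turns conditions on y-derivatives into
    conditions on x-derivatives. *)
Definition swap b : V -> V -> V -> V -> R := fun u v w z => b w z u v.

Lemma swap_polarized b : polarized b -> polarized (swap b).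
Proof. by case=> *; split; rewrite /swap. Qed.

Lemma polDl2 b (hb : polarized b) u v v' w z :
  b u (v + v') w z = b u v w z + b u v' w z.
Proof. by rewrite !(polCl hb u) polDl. Qed.

Lemma polZl2 b (hb : polarized b) c u v w z : b u (c *: v) w z = c * b u v w z.
Proof. by rewrite !(polCl hb u) polZl. Qed.

Lemma polDr2 b (hb : polarized b) u v w z z' :
  b u v w (z + z') = b u v w z + b u v w z'.
Proof. by rewrite !(polCr hb u v w) polDr. Qed.

Lemma polZr2 b (hb : polarized b) c u v w z : b u v w (c *: z) = c * b u v w z.
Proof. by rewrite !(polCr hb u v w) polZr. Qed.

Definition polE b (hb : polarized b) := (polDl hb, polZl hb, polDr hb, polZr hb,
  polDl2 hb, polZl2 hb, polDr2 hb, polZr2 hb).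

Lemma polarized_eq0 b : polarized b -> (forall u w, b u u w w = 0) ->
  forall u v w z, b u v w z = 0.
Proof.
move=> hb h0; have h1 u w z : b u u w z = 0.
  have := h0 u (w + z); rewrite !polE // !h0 (polCr hb _ _ z w); lra.
move=> u v w z; have := h1 (u + v) w z.
by rewrite !polE // !h1 (polCl hb v u); lra.
Qed.

Definition nonneg_form b := forall u w, 0 <= b u u w w.

Lemma polarized_CS b : polarized b -> nonneg_form b ->
  forall u w z, b u u w z ^+ 2 <= b u u w w * b u u z z.
Proof.
move=> hb b0 u w z; apply: discriminant_le => // c.
by have := b0 u (w + c *: z); rewrite !polE // (polCr hb _ _ z w); congr (_ <= _); ring.
Qed.

(** A zero is a minimum of a nonnegative form, hence a critical point in y. *)
Lemma vanishing_at_zero b : polarized b -> nonneg_form b ->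
  forall u w z, b u u w w <= 0 -> b u u w z = 0.
Proof.
move=> hb b0 u w z h; apply/eqP; rewrite -sqrf_eq0 eq_le sqr_ge0 andbT.
apply: (le_trans (polarized_CS hb b0 _ _ _)).
by rewrite mulr_le0_ge0.
Qed.

(** Cauchy-Schwarz bounds the square of the cubic polynomial
    s |-> b(x,x;y,z), x = u + s v, y = s u + v, by a multiple of
    (1 + s^2) (s^2 - t^2)^2; the equations say that s^2 - t^2 divides it. *)
Lemma face_zero_eqs b t u v : polarized b -> nonneg_form b ->
  (forall s, b (u + s *: v) (u + s *: v) (s *: u + v) (s *: u + v)
             <= (s ^+ 2 - t ^+ 2) ^+ 2) ->
  forall z,
    b u u v z + t ^+ 2 * (2 * b u v u z + b v v v z) = 0 /\
    b u u u z + 2 * b u v v z + t ^+ 2 * b v v u z = 0.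
Proof.
move=> hb b0 hf z.
have h s : (b u u v z + (b u u u z + 2 * b u v v z) * s
     + (2 * b u v u z + b v v v z) * s ^+ 2 + b v v u z * s ^+ 3) ^+ 2
    <= (2 * (b u u z z + b v v z z)) * (1 + s ^+ 2) * (s ^+ 2 - t ^+ 2) ^+ 2.
  have := polarized_CS hb b0 (u + s *: v) (s *: u + v) z.
  rewrite {1}(_ : b _ _ _ z = b u u v z + (b u u u z + 2 * b u v v z) * s
     + (2 * b u v u z + b v v v z) * s ^+ 2 + b v v u z * s ^+ 3); last first.
    by rewrite !polE // !(polCl hb v u); ring.
  move/le_trans; apply; rewrite mulrC ler_pM //.
  (* parallelogram law: the value at u + s v is at most the sum of those at
     u + s v and u - s v, which has no term linear in s *)
  have := b0 (u - s *: v) z.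
  rewrite -scaleNr !polE // !(polCl hb v u).
  by have := b0 u z; have := b0 v z; have := sqr_ge0 s; nra.
by apply: divisible_of_sqr_le h; have := b0 u z; have := b0 v z; lra.
Qed.

(** The derivative b(x,x;x,z) vanishes at the four sign vectors (up to global
    sign).  Averaging against the characters of the sign group separates the
    monomials: the first equation belongs to the character of u, the second to
    the product of the three characters.  The characters of v and w are obtained
    by permuting the vectors. *)
Lemma sign_zero_eqs b u v w : polarized b -> nonneg_form b ->
  (forall al be ga : R, al ^+ 2 = 1 -> be ^+ 2 = 1 -> ga ^+ 2 = 1 ->
     let x := al *: u + be *: v + ga *: w in b x x x x <= 0) ->
  forall z,
    b u u u z + b v v u z + b w w u z + 2 * b u v v z + 2 * b u w w z = 0 /\
    b u v w z + b u w v z + b v w u z = 0.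
Proof.
move=> hb b0 h z.
(* the global sign is normalized by giving u the coefficient 1 *)
have key (al be : R) : al ^+ 2 = 1 -> be ^+ 2 = 1 ->
    let x := u + al *: v + be *: w in b x x x z = 0.
  move=> ha hbe x; apply: vanishing_at_zero => //.
  by have := h 1 al be (expr1n _ _) ha hbe; rewrite scale1r.
have n1 : (-1) ^+ 2 = 1 :> R by rewrite sqrrN expr1n.
have p1 : 1 ^+ 2 = 1 :> R by rewrite expr1n.
have := key 1 1 p1 p1; have := key 1 (-1) p1 n1.
have := key (-1) 1 n1 p1; have := key (-1) (-1) n1 n1.
by rewrite /= !polE // !(polCl hb v u) !(polCl hb w u) !(polCl hb w v); split; lra.
Qed.

(** * The linear equations on a form below p *)

(** What remains of 0 <= b <= p for the basis (u,v,w): the bounds along the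
    three curves and at the sign vectors.  Unlike the coefficients of p, these
    conditions have an evident cyclic symmetry and are stable under [swap],
    with the cyclic order reversed, so that each sector of equations need be
    solved only once. *)
Record dominated t b u v w : Prop := Dominated {
  dom_pol : polarized b;
  dom_ge0 : nonneg_form b;
  dom_uv : forall s, b (u + s *: v) (u + s *: v) (s *: u + v) (s *: u + v)
             <= (s ^+ 2 - t ^+ 2) ^+ 2;
  dom_vw : forall s, b (v + s *: w) (v + s *: w) (s *: v + w) (s *: v + w)
             <= (s ^+ 2 - t ^+ 2) ^+ 2;
  dom_wu : forall s, b (w + s *: u) (w + s *: u) (s *: w + u) (s *: w + u)
             <= (s ^+ 2 - t ^+ 2) ^+ 2;
  dom_sign : forall al be ga : R, al ^+ 2 = 1 -> be ^+ 2 = 1 -> ga ^+ 2 = 1 ->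
     let x := al *: u + be *: v + ga *: w in b x x x x <= 0
}.

Lemma dominated_rot t b u v w : dominated t b u v w -> dominated t b v w u.
Proof.
case=> hb b0 h1 h2 h3 h4; split=> // al be ga ha hbe hga.
by have := h4 ga al be hga ha hbe; rewrite -addrA addrC.
Qed.

Lemma dominated_swap t b u v w :
  dominated t b u v w -> dominated t (swap b) w v u.
Proof.
case=> hb b0 h1 h2 h3 h4; split=> //; rewrite /swap; first exact: swap_polarized.
- by move=> x y; apply: b0.
- by move=> s; have := h2 s; rewrite (addrC v) (addrC _ w).
- by move=> s; have := h1 s; rewrite (addrC u) (addrC _ v).
- by move=> s; have := h3 s; rewrite (addrC w) (addrC _ u).
- move=> al be ga ha hbe hga.
  rewrite (_ : _ + ga *: u = ga *: u + be *: v + al *: w); first exact: h4.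
  by rewrite addrC [X in _ + X]addrC addrA.
Qed.

(** The sign-invariant coefficients supported on the indices of u and v: a
    face leaves two of the five free. *)
Lemma face_diagonal t b u v w : dominated t b u v w ->
  [/\ b v v v v = b u u u u, b u u v v = t ^+ 4 * b v v u u &
      2 * b u v u v = - b u u u u - t ^+ 2 * b v v u u].
Proof.
move=> hd; have [hb b0 f1 _ _ _] := hd.
have [hb' b0' _ f2 _ _] := dominated_swap hd.
have [E1 _] := face_zero_eqs hb b0 f1 v; have [_ E2] := face_zero_eqs hb b0 f1 u.
have [_ E4] := face_zero_eqs hb' b0' f2 v.
move: E1 E2 E4; rewrite /swap (polCr hb _ _ v u) => E1 E2 E4.
have a_eq : b v v v v = b u u u u by lra.
have B_eq : 2 * b u v u v = - b u u u u - t ^+ 2 * b v v u u by lra.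
by split=> //; move: E1; rewrite B_eq a_eq; lra.
Qed.

(** The faces (u,v) and (w,u) meet in the square of u.  Writing c1 and c3 for
    the free coefficients of these faces and s = t^2, the derivatives in y and
    in x at the sign vectors read c1 + s^2 c3 - s (c1 + c3) = b(u,u;u,u) and
    c3 + s^2 c1 - s (c1 + c3) = b(u,u;u,u); their difference is
    (1 - s^2) (c1 - c3) = 0. *)
Lemma diagonal_corner t b u v w : t ^+ 2 != 1 -> dominated t b u v w ->
  b u u w w = b v v u u /\ b u u u u = (t ^+ 2 - 1) ^+ 2 * b v v u u.
Proof.
move=> t1 hd; have hd' := dominated_rot (dominated_rot hd).
have hs := dominated_swap hd.
have [_ A1 B1] := face_diagonal hd.
have [A3 A3' B3] := face_diagonal hd'.
have [S _] := sign_zero_eqs (dom_pol hd) (dom_ge0 hd) (dom_sign hd) u.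
have hr := dominated_rot (dominated_rot hs).
have [S' _] := sign_zero_eqs (dom_pol hr) (dom_ge0 hr) (dom_sign hr) u.
move: S S' A1 B1 A3' B3; rewrite /swap !(polCr (dom_pol hd) _ _ v u).
rewrite !(polCr (dom_pol hd) _ _ w u).
rewrite !(polCl (dom_pol hd) w u) !(polCl (dom_pol hd) v u) A3.
set s := t ^+ 2; rewrite (_ : t ^+ 4 = s ^+ 2); last by rewrite -exprM.
have s0 : 0 <= s by apply: sqr_ge0.
move=> S S' A1 B1 A3' B3.
have eqc : b u u w w = b v v u u.
  have : (1 - s) * (1 + s) * (b u u w w - b v v u u) = 0.
    rewrite B1 B3 A1 A3' in S S'; rewrite -[RHS](subrr 0) -{1}S' -S; ring.
  move/eqP; rewrite !mulf_eq0 subr_eq0 eq_sym (negbTE t1) /= => /orP[|]; last first.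
    by rewrite subr_eq0 => /eqP.
  by move/eqP; lra.
split=> //; rewrite B1 B3 A3' eqc in S; move: S => S.
by rewrite -[LHS]addr0 -[in LHS]S; ring.
Qed.

(** In p the monomial x_1^2 y_0^2 has coefficient 1, so b(v,v;u,u) is the factor
    by which b differs from p. *)
Lemma diagonal_sector t b u v w : t ^+ 2 != 1 -> dominated t b u v w ->
  let c := b v v u u in
  [/\ b u u u u = (t ^+ 2 - 1) ^+ 2 * c, b u u v v = t ^+ 4 * c,
      2 * b u v u v = - (t ^+ 4 - t ^+ 2 + 1) * c & b u u w w = c].
Proof.
move=> t1 hd; have [_ A B] := face_diagonal hd.
by have [C D] := diagonal_corner t1 hd; split=> //; rewrite B D; ring.
Qed.

(** The coefficients with the character of the product of the signs of u and v:
    fourteen linear equations for eight unknowns.  Of the four that involve only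
    u and v, the face (u,v) leaves one free when t <> 0 and two when t = 0; the
    other faces and the sign vectors eliminate them. *)
Lemma offdiagonal_sector t b u v w : t ^+ 2 != 1 -> dominated t b u v w ->
  [/\ b u v u u = 0, b u v v v = 0, b u u u v = 0 & b v v u v = 0] /\
  [/\ b u v w w = 0, b w w u v = 0, b u w v w = 0 & b v w u w = 0].
Proof.
move=> t1 hd; have hd' := dominated_rot hd; have hd'' := dominated_rot hd'.
have hs := dominated_swap hd; have hs' := dominated_rot hs.
have hs'' := dominated_rot hs'.
have [hb b0 f1 f2 f3 f4] := hd; have [hb' b0' g1 g2 g3 g4] := hs.
have [E1 _] := face_zero_eqs hb b0 f1 u.
have [_ E2] := face_zero_eqs hb b0 f1 v.
have [E3 _] := face_zero_eqs hb' b0' g2 v.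
have [_ E4] := face_zero_eqs hb' b0' g2 u.
have [_ F2] := face_zero_eqs hb b0 f2 u.
have [F3 _] := face_zero_eqs hb' b0' g1 u.
have [G1 _] := face_zero_eqs hb b0 f3 v.
have [_ G4] := face_zero_eqs hb' b0' g3 v.
have [Yu _] := sign_zero_eqs hb b0 f4 v.
have [Yv _] := sign_zero_eqs hb b0 (dom_sign hd') u.
have [_ Yw] := sign_zero_eqs hb b0 f4 w.
have [Xu _] := sign_zero_eqs hb' b0' (dom_sign hs'') v.
have [Xv _] := sign_zero_eqs hb' b0' (dom_sign hs') u.
have [_ Xw] := sign_zero_eqs hb' b0' g4 w.
move: E1 E2 E3 E4 F2 F3 G1 G4 Yu Yv Yw Xu Xv Xw; rewrite /swap.
rewrite !(polCr hb _ _ v u) !(polCr hb _ _ w u) !(polCr hb _ _ w v).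
rewrite !(polCl hb v u) !(polCl hb w u) !(polCl hb w v).
set s := t ^+ 2.
set P := b u v u u; set Q := b u v v v; set S := b u u u v; set T := b v v u v.
set m := b u v w w; set n := b w w u v; set p := b u w v w; set q := b v w u w.
move=> E1 E2 E3 E4 F2 F3 G1 G4 Yu Yv Yw Xu Xv Xw.
have mn : n = m by lra.
have TP : T = P by rewrite mn in F2; lra.
rewrite {}mn {}TP in E1 E2 E3 E4 F2 F3 G1 G4 Yu Yv Yw Xu Xv Xw *.
have sP : s * P = 0 by lra.
have Q0 : Q = 0 by lra.
have S0 : S = 0 by lra.
have P0 : P = 0 by lra.
have pq : q = p by lra.
have mp : m = - 2 * p by lra.
have p0 : p = 0.
  have : (s - 1) * p = 0 by move: F3; rewrite Q0 mp; lra.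
  by move/eqP; rewrite mulf_eq0 subr_eq0 (negbTE t1) /= => /eqP.
by rewrite mp pq Q0 S0 P0 p0 mulr0.
Qed.

(** The biquadratic form of Phi_t in coordinates, see [polar_Phi]; for t = 0 it is
    the form of Choi's map. *)
Definition choi_form t (x0 x1 x2 y0 y1 y2 : R) : R :=
  (t ^+ 2 - 1) ^+ 2 * (x0 ^+ 2 * y0 ^+ 2 + x1 ^+ 2 * y1 ^+ 2 + x2 ^+ 2 * y2 ^+ 2)
  + (x1 ^+ 2 * y0 ^+ 2 + x2 ^+ 2 * y1 ^+ 2 + x0 ^+ 2 * y2 ^+ 2)
  + t ^+ 4 * (x2 ^+ 2 * y0 ^+ 2 + x0 ^+ 2 * y1 ^+ 2 + x1 ^+ 2 * y2 ^+ 2)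
  - 2 * (t ^+ 4 - t ^+ 2 + 1)
    * (x0 * x1 * y0 * y1 + x0 * x2 * y0 * y2 + x1 * x2 * y1 * y2).

(** A form below p is a multiple of p: the sectors give all coefficients. *)
Lemma dominated_form t b u v w : t ^+ 2 != 1 -> dominated t b u v w ->
  forall x0 x1 x2 y0 y1 y2 : R,
    let x := x0 *: u + x1 *: v + x2 *: w in
    let y := y0 *: u + y1 *: v + y2 *: w in
    b x x y y = b v v u u * choi_form t x0 x1 x2 y0 y1 y2.
Proof.
move=> t1 hd x0 x1 x2 y0 y1 y2 x y.
have hd' := dominated_rot hd; have hd'' := dominated_rot hd'.
have [A1 A2 A3 A4] := diagonal_sector t1 hd.
have [A1' A2' A3' A4'] := diagonal_sector t1 hd'.
have [A1'' A2'' A3'' A4''] := diagonal_sector t1 hd''.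
have [[O1 O2 O3 O4] [O5 O6 O7 O8]] := offdiagonal_sector t1 hd.
have [[P1 P2 P3 P4] [P5 P6 P7 P8]] := offdiagonal_sector t1 hd'.
have [[Q1 Q2 Q3 Q4] [Q5 Q6 Q7 Q8]] := offdiagonal_sector t1 hd''.
have hb := dom_pol hd.
rewrite /x /y !polE //.
move: A3 A3' A3'' O1 O2 O3 O4 O5 O6 O7 O8 P1 P2 P3 P4 P5 P6 P7 P8 Q1 Q2 Q3 Q4 Q5 Q6 Q7 Q8.
rewrite !(polCr hb _ _ v u) !(polCr hb _ _ w u) !(polCr hb _ _ w v).
rewrite !(polCl hb v u) !(polCl hb w u) !(polCl hb w v).
move=> A3 A3' A3''.
do 24 (move=> ->).
rewrite A1 A2 A1' A2' A1'' A2'' A4' A4'' in A3 A3' A3'' *.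
have half (a c : R) : 2 * a = c -> a = c / 2 by lra.
rewrite (half _ _ A3) (half _ _ A3') (half _ _ A3'') A4 A4' A4''.
by rewrite /choi_form; field.
Qed.
End Polarized.

(** * Nonnegativity of the biquadratic form *)

Section ChoiForm.
Variable R : realFieldType.
Implicit Types (a c d s t x y : R).

Lemma choi_form_rot t x0 x1 x2 y0 y1 y2 :
  choi_form t x1 x2 x0 y1 y2 y0 = choi_form t x0 x1 x2 y0 y1 y2.
Proof. by rewrite /choi_form; ring. Qed.

(** The determinant of Phi_t(x x^T) is (s - 1)^2 times this cubic in the squares
    of the coordinates, see [choi_det].  It vanishes at (1,1,1) and at (1,s,0)
    and its cyclic shifts. *)
Definition choi_cubic s x y z : R :=
  s ^+ 2 * (x ^+ 3 + y ^+ 3 + z ^+ 3)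
  + (s ^+ 4 - 2 * s) * (x ^+ 2 * y + y ^+ 2 * z + z ^+ 2 * x)
  + (1 - 2 * s ^+ 3) * (x * y ^+ 2 + y * z ^+ 2 + z * x ^+ 2)
  - 3 * ((s ^+ 2 - s + 1) ^+ 2 - 2 * s ^+ 2) * (x * y * z).

Lemma choi_cubic_rot s x y z : choi_cubic s y z x = choi_cubic s x y z.
Proof. by rewrite /choi_cubic; ring. Qed.

(** By cyclic symmetry the last variable may be taken to be the smallest. *)
Lemma choi_cubic_ge0 s x y z : 0 <= s -> 0 <= x -> 0 <= y -> 0 <= z ->
  0 <= choi_cubic s x y z.
Proof.
move=> s0.
have base (u v w : R) : 0 <= w -> w <= u -> w <= v -> 0 <= choi_cubic s u v w.
  move=> w0 wu wv.
  (* there is no term linear in (u - w, v - w): by cyclic symmetry and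
     homogeneity (1,1,1) is a critical point *)
  rewrite (_ : choi_cubic _ _ _ _ = w * ((s ^+ 2 - s + 1) ^+ 2 *
      ((u - w) ^+ 2 - (u - w) * (v - w) + (v - w) ^+ 2))
    + (s * (u - w) - (v - w)) ^+ 2 * ((u - w) + s ^+ 2 * (v - w))); last first.
    by rewrite /choi_cubic; ring.
  rewrite addr_ge0 // mulr_ge0 ?sqr_ge0 //.
    have quad (p q : R) : 0 <= p ^+ 2 - p * q + q ^+ 2.
      by have := sqr_ge0 (p - q); have := sqr_ge0 p; have := sqr_ge0 q; nra.
    by rewrite mulr_ge0 ?sqr_ge0.
  by rewrite addr_ge0 ?subr_ge0 // mulr_ge0 ?sqr_ge0 ?subr_ge0.
move=> x0 y0 z0; have [xy|yx] := lerP x y; have [yz|zy] := lerP y z.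
- by rewrite -choi_cubic_rot base //; lra.
- have [xz|zx] := lerP x z; last by rewrite base //; lra.
  by rewrite -choi_cubic_rot base.
- by rewrite -2!choi_cubic_rot base //; lra.
- by rewrite base //; lra.
Qed.

(** Semidefiniteness of diag(e) - d x x^T, for positive e, from its
    determinant: after multiplication by e0 e1 e2 the difference of both sides
    is the determinant times the diagonal form, plus d times the defect of
    the weighted Cauchy-Schwarz inequality in Lagrange's form. *)
Lemma diag_sub_rank1_ge0 d e0 e1 e2 x0 x1 x2 y0 y1 y2 :
  0 <= d -> 0 < e0 -> 0 < e1 -> 0 < e2 ->
  d * (x0 ^+ 2 * e1 * e2 + x1 ^+ 2 * e0 * e2 + x2 ^+ 2 * e0 * e1)
    <= e0 * e1 * e2 ->
  d * (x0 * y0 + x1 * y1 + x2 * y2) ^+ 2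
    <= e0 * y0 ^+ 2 + e1 * y1 ^+ 2 + e2 * y2 ^+ 2.
Proof.
move=> d0 p0 p1 p2; rewrite -subr_ge0 => det0.
have ep : 0 < e0 * e1 * e2 by rewrite !mulr_gt0.
rewrite -subr_ge0 -(pmulr_rge0 _ ep).
set D := _ - _ in det0.
rewrite (_ : e0 * e1 * e2 * _ = D * (e0 * y0 ^+ 2 + e1 * y1 ^+ 2 + e2 * y2 ^+ 2)
  + d * (e2 * (x0 * e1 * y1 - x1 * e0 * y0) ^+ 2
       + e1 * (x0 * e2 * y2 - x2 * e0 * y0) ^+ 2
       + e0 * (x1 * e2 * y2 - x2 * e1 * y1) ^+ 2)); last by rewrite /D; ring.
have sq (e z : R) : 0 < e -> 0 <= e * z ^+ 2.
  by move=> e_gt0; rewrite mulr_ge0 ?sqr_ge0 // ltW.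
by rewrite addr_ge0 // mulr_ge0 // !addr_ge0 // sq.
Qed.

(** The first diagonal entry of Phi_t(x x^T) + d x x^T, which is a diagonal
    matrix; the other entries are its cyclic shifts. *)
Definition choi_diag s x y z : R :=
  ((s - 1) ^+ 2 + (s ^+ 2 - s + 1)) * x ^+ 2 + y ^+ 2 + (s * z) ^+ 2.

Lemma choi_formE t x0 x1 x2 y0 y1 y2 : let s := t ^+ 2 in
  choi_form t x0 x1 x2 y0 y1 y2 =
  choi_diag s x0 x1 x2 * y0 ^+ 2 + choi_diag s x1 x2 x0 * y1 ^+ 2
    + choi_diag s x2 x0 x1 * y2 ^+ 2
    - (s ^+ 2 - s + 1) * (x0 * y0 + x1 * y1 + x2 * y2) ^+ 2.
Proof. by rewrite /choi_form /choi_diag; ring. Qed.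

Lemma choi_det s x0 x1 x2 :
  let e0 := choi_diag s x0 x1 x2 in let e1 := choi_diag s x1 x2 x0 in
  let e2 := choi_diag s x2 x0 x1 in
  e0 * e1 * e2 - (s ^+ 2 - s + 1) *
    (x0 ^+ 2 * e1 * e2 + x1 ^+ 2 * e0 * e2 + x2 ^+ 2 * e0 * e1)
  = (s - 1) ^+ 2 * choi_cubic s (x0 ^+ 2) (x1 ^+ 2) (x2 ^+ 2).
Proof. by rewrite /choi_diag /choi_cubic; ring. Qed.

(** A diagonal entry can vanish only when two coordinates of x do, and then
    the form has no mixed terms. *)
Lemma choi_form_ge0 t x0 x1 x2 y0 y1 y2 : 0 <= choi_form t x0 x1 x2 y0 y1 y2.
Proof.
have axis (z w0 w1 w2 : R) : 0 <= choi_form t 0 0 z w0 w1 w2.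
  rewrite (_ : choi_form _ _ _ _ _ _ _ =
    z ^+ 2 * (((t ^+ 2 - 1) * w2) ^+ 2 + w1 ^+ 2 + (t ^+ 2 * w0) ^+ 2)).
    by rewrite mulr_ge0 ?sqr_ge0 // !addr_ge0 ?sqr_ge0.
  by rewrite /choi_form; ring.
have d0 : 0 < (t ^+ 2) ^+ 2 - t ^+ 2 + 1 by have := sqr_ge0 (t ^+ 2 - 1); nra.
have diag_gt0 (x y z : R) : (x != 0) || (y != 0) -> 0 < choi_diag (t ^+ 2) x y z.
  have ad : 0 < (t ^+ 2 - 1) ^+ 2 + ((t ^+ 2) ^+ 2 - t ^+ 2 + 1).
    by rewrite ltr_wpDl ?sqr_ge0.
  move=> /orP[] h; rewrite /choi_diag.
    rewrite ltr_pwDl ?sqr_ge0 // ltr_pwDl ?sqr_ge0 //.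
    by rewrite mulr_gt0 // exprn_even_gt0.
  rewrite ltr_pwDl ?sqr_ge0 // ltr_wpDl // ?exprn_even_gt0 //.
  by rewrite mulr_ge0 ?sqr_ge0 // ltW.
have [/andP[/eqP-> /eqP->]|] := boolP ((x0 == 0) && (x1 == 0)); first exact: axis.
rewrite negb_and => /diag_gt0-/(_ x2) e0.
have [/andP[/eqP-> /eqP->]|] := boolP ((x1 == 0) && (x2 == 0)).
  by rewrite -choi_form_rot; exact: axis.
rewrite negb_and => /diag_gt0-/(_ x0) e1.
have [/andP[/eqP-> /eqP->]|] := boolP ((x2 == 0) && (x0 == 0)).
  by rewrite choi_form_rot; exact: axis.
rewrite negb_and => /diag_gt0-/(_ x1) e2.
rewrite choi_formE subr_ge0 diag_sub_rank1_ge0 // ?(ltW d0) //.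
by rewrite -subr_ge0 choi_det mulr_ge0 ?choi_cubic_ge0 ?sqr_ge0.
Qed.
End ChoiForm.

(** * Positive semidefinite matrices as sums of rank-one matrices *)

Section Psd.
Variable R : realType.
Implicit Types (A B : 'M[R]_3) (x y v : 'cV[R]_3).

Lemma psd_CS A x y : A^T = A -> psd A ->
  ((x^T *m A *m y) 0 0) ^+ 2 <= (x^T *m A *m x) 0 0 * (y^T *m A *m y) 0 0.
Proof.
move=> symA psdA; apply: discriminant_le => [|c]; first exact: psdA.
have sym : (y^T *m A *m x) 0 0 = (x^T *m A *m y) 0 0.
  by rewrite -[y^T *m A *m x]trmxK mxE !trmx_mul trmxK symA mulmxA.
have := psdA (x + c *: y).
rewrite [(_ + _)^T]linearD /= [(c *: _)^T]linearZ /= !mulmxDl !mulmxDr -!scalemxAl -!scalemxAr.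
move: sym; rewrite !mxE => ->; congr (_ <= _); ring.
Qed.

Lemma outer_entry v i j : (v *m v^T) i j = v i 0 * v j 0.
Proof. by rewrite mxE big_ord1 mxE. Qed.

(** One step of Gaussian elimination: subtracting the rank-one matrix of the
    i-th column clears the i-th row, and Cauchy-Schwarz keeps the difference
    positive semidefinite.  Rows already cleared stay so. *)
Lemma psd_peel A i : A^T = A -> psd A ->
  exists c v B, [/\ 0 <= c, A = c *: (v *m v^T) + B, B^T = B, psd B &
    (forall j, B i j = 0) /\
    forall k, (forall j, A k j = 0) -> forall j, B k j = 0].
Proof.
move=> symA psdA; pose e := delta_mx i 0 : 'cV[R]_3.
pose v := A *m e; pose c := ((e^T *m A *m e) 0 0)^-1.
have vk k : v k 0 = A k i by rewrite /v -colE mxE.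
have eAe : (e^T *m A *m e) 0 0 = A i i by rewrite -mulmxA trmx_delta -rowE mxE vk.
have vx x : v^T *m x = e^T *m A *m x by rewrite /v trmx_mul symA.
exists c, v, (A - c *: (v *m v^T)); split.
- by rewrite invr_ge0; exact: psdA.
- by rewrite addrC subrK.
- by rewrite linearB linearZ /= trmx_mul trmxK symA.
- move=> x; rewrite mulmxBr mulmxBl -scalemxAr -scalemxAl mxE [X in _ + X]mxE.
  rewrite [X in - X]mxE.
  have -> : (x^T *m (v *m v^T) *m x) 0 0 = ((e^T *m A *m x) 0 0) ^+ 2.
    rewrite mulmxA -[_ *m x]mulmxA mxE big_ord1 expr2 vx; congr (_ * _).
    by rewrite -vx -[x^T *m v]trmxK mxE trmx_mul trmxK.
  have := psd_CS e x symA psdA; rewrite -/c subr_ge0 /c.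
  (* if A i i = 0 then c = 0 and nothing is subtracted *)
  have [->|n0] := eqVneq ((e^T *m A *m e) 0 0) 0.
    by rewrite invr0 !mul0r => _; apply: psdA.
  by rewrite ler_pdivrMl // lt_def n0 psdA.
- have entry k j : (A - c *: (v *m v^T)) k j = A k j - c * (A k i * A j i).
    by rewrite mxE [X in _ + X]mxE [X in - X]mxE outer_entry !vk.
  split=> [j|k Ak0 j]; rewrite entry; last first.
    by rewrite !Ak0; ring.
  have := psd_CS e (delta_mx j 0) symA psdA.
  rewrite /c eAe -[_ *m delta_mx j 0]mulmxA -colE trmx_delta -rowE !mxE.
  have -> : A j i = A i j by rewrite -[in LHS]symA mxE.
  (* if A i i = 0, Cauchy-Schwarz says that the row is already zero *)
  have [->|n0 _] := eqVneq (A i i) 0; last by rewrite mulKf // subrr.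
  by rewrite !mul0r !mulr0 subr0 => h; apply/eqP; rewrite -sqrf_eq0 eq_le sqr_ge0 andbT.
Qed.

Lemma sum3 (V : nmodType) (f : 'I_3 -> V) : \sum_(i < 3) f i = f 0 + f 1 + f 2.
Proof.
rewrite !big_ord_recl big_ord0 addr0 addrA.
by congr (f _ + f _ + f _); apply/val_inj.
Qed.

Lemma psd_sum A : A^T = A -> psd A ->
  exists (c : 'I_3 -> R) (v : 'I_3 -> 'cV[R]_3),
    (forall i, 0 <= c i) /\ A = \sum_i c i *: (v i *m (v i)^T).
Proof.
move=> symA psdA.
have [c0 [v0 [B0 [c0_ge0 eqA sym0 psd0 [B00 _]]]]] := psd_peel 0 symA psdA.
have [c1 [v1 [B1 [c1_ge0 eq0 sym1 psd1 [B11 k1]]]]] := psd_peel 1 sym0 psd0.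
have [c2 [v2 [B2 [c2_ge0 eq1 sym2 psd2 [B22 k2]]]]] := psd_peel 2 sym1 psd1.
pose f (T : Type) (a b c : T) (i : 'I_3) := nth a [:: a; b; c] i.
exists (f _ c0 c1 c2), (f _ v0 v1 v2); split.
  by case=> [[|[|[|]]]].
rewrite sum3 /f /= eqA eq0 eq1 (_ : B2 = 0) ?addr0 ?addrA //.
apply/matrixP => i j; rewrite mxE.
case: i => [[|[|[|]]] //] hi.
- by rewrite (_ : Ordinal hi = 0); [exact: (k2 _ (k1 _ B00)) | apply/val_inj].
- by rewrite (_ : Ordinal hi = 1); [exact: k2 | apply/val_inj].
- by rewrite (_ : Ordinal hi = 2); [exact: B22 | apply/val_inj].
Qed.

End Psd.

(** * Maps on symmetric matrices and their biquadratic forms *)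

Section Polar.
Variable R : realType.
Implicit Types (F G : 'End(Sym3 R)) (x y z w : 'cV[R]_3).

Lemma Sym3_inj (Y Z : Sym3 R) : vsval Y = vsval Z -> Y = Z.
Proof. exact: val_inj. Qed.

Lemma Sym3D (Y Z : Sym3 R) : vsval (Y + Z) = vsval Y + vsval Z.
Proof. exact: linearD. Qed.

Lemma Sym3Z c (Z : Sym3 R) : vsval (c *: Z) = c *: vsval Z.
Proof. exact: linearZ. Qed.

Lemma Sym3_sum (I : finType) (Z : I -> Sym3 R) :
  vsval (\sum_i Z i) = \sum_i vsval (Z i).
Proof. exact: linear_sum. Qed.

(** The symmetric product (x y^T + y x^T) / 2, written as a polarization so that
    it lies in the space of symmetric matrices by construction. *)
Definition symprod x y : Sym3 R := 2^-1 *: (outer (x + y) - outer x - outer y).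

Lemma val_symprod x y : vsval (symprod x y) = 2^-1 *: (x *m y^T + y *m x^T).
Proof.
rewrite linearZ !linearB /=; congr (_ *: _).
by apply/matrixP => i j; rewrite !(mxE, big_ord1); ring.
Qed.

Lemma symprodC x y : symprod x y = symprod y x.
Proof. by apply/Sym3_inj; rewrite !val_symprod addrC. Qed.

Lemma symprod_outer x : symprod x x = outer x.
Proof.
by apply/Sym3_inj; rewrite val_symprod /= -mulr2n -scaler_nat scalerA mulVf ?pnatr_eq0 // scale1r.
Qed.

Lemma symprodDl x x' y : symprod (x + x') y = symprod x y + symprod x' y.
Proof.
apply/Sym3_inj; rewrite Sym3D !val_symprod [(_ + _)^T]linearD mulmxDl mulmxDr -scalerDr.
by rewrite addrACA.
Qed.

Lemma symprodZl c x y : symprod (c *: x) y = c *: symprod x y.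
Proof.
apply/Sym3_inj; rewrite val_symprod Sym3Z val_symprod [(_ *: _)^T]linearZ -scalemxAl -scalemxAr.
by rewrite -scalerDr !scalerA mulrC.
Qed.

(** The polarized biquadratic form of F; on the diagonal it is
    z^T F(x x^T) z. *)
Definition polar F x y z w : R := (z^T *m vsval (F (symprod x y)) *m w) 0 0.

Lemma polarized_polar F : polarized (polar F).
Proof.
rewrite /polar; split=> [u u' v w z|c u v w z|u v w z|u v w w' z|c u v w z|u v w z].
- by rewrite symprodDl (linearD F) Sym3D mulmxDr mulmxDl mxE.
- by rewrite symprodZl [F _]linearZ Sym3Z -scalemxAr -scalemxAl mxE.
- by rewrite symprodC.
- by rewrite [(_ + _)^T]linearD !mulmxDl mxE.
- by rewrite [(_ *: _)^T]linearZ -!scalemxAl mxE.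
- rewrite -[w^T *m _ *m z]trmxK mxE !trmx_mul trmxK mulmxA.
  by have := valP (F (symprod u v)); rewrite mem_symv => /eqP->.
Qed.

Lemma polarD F G x y z w : polar (F + G) x y z w = polar F x y z w + polar G x y z w.
Proof. by rewrite /polar lfunE Sym3D mulmxDr mulmxDl mxE. Qed.

Lemma polarZ c F x y z w : polar (c *: F) x y z w = c * polar F x y z w.
Proof. by rewrite /polar lfunE Sym3Z -scalemxAr -scalemxAl mxE. Qed.

Definition evec (i : 'I_3) : 'cV[R]_3 := delta_mx i 0.

Lemma Sym3_span (Z : Sym3 R) :
  Z = \sum_i \sum_j vsval Z i j *: symprod (evec i) (evec j).
Proof.
apply/Sym3_inj; set M := vsval Z.
have MT : M^T = M by have := valP Z; rewrite mem_symv => /eqP.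
have half (N : 'M[R]_3) :
    \sum_i \sum_j N i j *: (2^-1 *: delta_mx i j) = 2^-1 *: N.
  rewrite {2}[N]matrix_sum_delta scaler_sumr; apply: eq_bigr => i _.
  by rewrite scaler_sumr; apply: eq_bigr => j _; rewrite !scalerA mulrC.
transitivity (2^-1 *: M + 2^-1 *: M^T).
  by rewrite MT -mulr2n -scaler_nat scalerA mulfV ?pnatr_eq0 // scale1r.
rewrite -(half M) -(half M^T) [X in _ + X]exchange_big Sym3_sum -big_split /=.
apply: eq_bigr => i _; rewrite Sym3_sum -big_split; apply: eq_bigr => j _.
rewrite [LHS]/= Sym3Z val_symprod !trmx_delta !mul_delta_mx mxE.
by rewrite -!scalerDr.
Qed.

(** The polarization recovers the values of a map on the products of basis
    vectors, and these span the symmetric matrices. *)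
Lemma polar_inj F G : (forall x y, polar F x x y y = polar G x x y y) -> F = G.
Proof.
move=> FG; have h0 x y : polar (F - G) x x y y = 0.
  by rewrite -[- G]scaleN1r polarD polarZ FG; ring.
apply/subr0_eq/lfunP => Z; rewrite zero_lfunE (Sym3_span Z) linear_sum.
rewrite big1 // => i _; rewrite linear_sum big1 // => j _; rewrite linearZ /=.
rewrite (_ : (F - G) (symprod _ _) = 0) ?scaler0 //.
apply/Sym3_inj/matrixP => k l.
have := polarized_eq0 (polarized_polar (F - G)) h0 (evec i) (evec j) (evec k) (evec l).
by rewrite /polar trmx_delta -rowE -colE !mxE.
Qed.

(** Rank-one matrices generate the cone of positive semidefinite matrices. *)
Lemma positive_mapP F :
  positive_map F <-> (forall x y, 0 <= polar F x x y y).
Proof.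
split=> [F0 x y|F0 Z psdZ y].
  rewrite /polar symprod_outer; apply: F0 => z.
  rewrite mulmxA -mulmxA -[z^T *m x]trmxK trmx_mul trmxK mxE big_ord1 mxE -expr2.
  exact: sqr_ge0.
have symZ : (vsval Z)^T = vsval Z by have := valP Z; rewrite mem_symv => /eqP.
have [c [v [c0 Ze]]] := psd_sum symZ psdZ.
have -> : Z = \sum_i c i *: outer (v i).
  by apply/Sym3_inj; rewrite Ze Sym3_sum; apply: eq_bigr => i _; rewrite Sym3Z.
rewrite linear_sum Sym3_sum mulmx_sumr mulmx_suml summxE sumr_ge0 // => i _.
rewrite linearZ Sym3Z -scalemxAr -scalemxAl mxE mulr_ge0 //.
by have := F0 (v i) y; rewrite /polar symprod_outer.
Qed.

Lemma polar_Phi t x y : polar (Phi t) x x y y =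
  choi_form t (x 0 0) (x 1 0) (x 2 0) (y 0 0) (y 1 0) (y 2 0).
Proof.
rewrite /polar symprod_outer PhiE mxE sum3 !mxE !sum3 !mxE.
rewrite /= !big_ord1 !mxE /choi_form.
ring.
Qed.

End Polar.

(** * Positivity, extremality and failure of complete positivity *)

Section PhiMap.
Variable R : realType.
Implicit Types (F G : 'End(Sym3 R)) (x y z w : 'cV[R]_3) (s t : R).

Lemma Phi_positive t : positive_map (Phi t).
Proof. by apply/positive_mapP => x y; rewrite polar_Phi choi_form_ge0. Qed.

Definition choi_at t x y : R :=
  choi_form t (x 0 0) (x 1 0) (x 2 0) (y 0 0) (y 1 0) (y 2 0).

Lemma choi_at_face t s : [/\
  choi_at t (evec R 0 + s *: evec R 1) (s *: evec R 0 + evec R 1) = (s ^+ 2 - t ^+ 2) ^+ 2,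
  choi_at t (evec R 1 + s *: evec R 2) (s *: evec R 1 + evec R 2) = (s ^+ 2 - t ^+ 2) ^+ 2 &
  choi_at t (evec R 2 + s *: evec R 0) (s *: evec R 2 + evec R 0) = (s ^+ 2 - t ^+ 2) ^+ 2].
Proof. by rewrite /choi_at !mxE /= /choi_form; split; ring. Qed.

(** The signs cancel in every monomial of p(x,x), so only (1,1,1) matters, where
    3 a + 3 + 3 t^4 = 6 d. *)
Lemma choi_at_signs t (a b c : R) : a ^+ 2 = 1 -> b ^+ 2 = 1 -> c ^+ 2 = 1 ->
  let x := a *: evec R 0 + b *: evec R 1 + c *: evec R 2 in choi_at t x x = 0.
Proof.
move=> a1 b1 c1; rewrite /choi_at !mxE /= !(mulr0, mulr1, addr0, add0r).
have sq (p q : R) : p * q * p * q = p ^+ 2 * q ^+ 2 by ring.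
by rewrite /choi_form !sq a1 b1 c1; ring.
Qed.

Lemma summand_dominated t F : positive_map F -> positive_map (Phi t - F) ->
  dominated t (polar F) (evec R 0) (evec R 1) (evec R 2).
Proof.
move=> /positive_mapP F0 /positive_mapP FP.
have le_choi x y : polar F x x y y <= choi_at t x y.
  by rewrite -subr_ge0 -mulN1r /choi_at -polar_Phi -polarZ -polarD scaleN1r.
split=> [||s|s|s|a b c a1 b1 c1]; first exact: polarized_polar.
- by move=> x y; apply: F0.
- by apply: le_trans (le_choi _ _) _; have [-> _ _] := choi_at_face t s.
- by apply: le_trans (le_choi _ _) _; have [_ -> _] := choi_at_face t s.
- by apply: le_trans (le_choi _ _) _; have [_ _ ->] := choi_at_face t s.
- by rewrite /=; apply: le_trans (le_choi _ _) _; rewrite choi_at_signs.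
Qed.

Lemma cV3_evec x : x = x 0 0 *: evec R 0 + x 1 0 *: evec R 1 + x 2 0 *: evec R 2.
Proof.
apply/matrixP => i j; rewrite (ord1 j) [LHS](_ : _ = \sum_k x k 0 * evec R k i 0).
  by rewrite sum3 !mxE.
rewrite (bigD1 i) //= big1 ?addr0 => [|k ki]; rewrite !mxE !eqxx ?mulr1 //.
by rewrite eq_sym (negbTE ki) mulr0.
Qed.

(** Both F and Phi_t - F positive means that the form of F lies between 0 and p. *)
Lemma summand_multiple t F : t ^+ 2 != 1 -> positive_map F ->
  positive_map (Phi t - F) -> exists c, F = c *: Phi t.
Proof.
move=> t1 F0 FP; have hd := summand_dominated F0 FP.
exists (polar F (evec R 1) (evec R 1) (evec R 0) (evec R 0)).
apply: polar_inj => x y; rewrite polarZ polar_Phi -(dominated_form t1 hd).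
by rewrite -!cV3_evec.
Qed.

Lemma free_multiples (V : vectType R) (v : V) (c d : R) :
  ~~ free [:: c *: v; d *: v].
Proof.
rewrite free_cons span_seq1 negb_and negbK.
have [->|d0] := eqVneq d 0; first by rewrite scale0r free_cons span_nil mem0v orbT.
have -> : c *: v = (c / d) *: (d *: v) by rewrite scalerA divfK.
by rewrite memvZ ?memv_line.
Qed.

Lemma Phi_extremal t : t ^+ 2 != 1 -> extremal (Phi t).
Proof.
move=> t1; split; first exact: Phi_positive.
case=> F1 [F2 [F1_ge0 F2_ge0 freeF Phi_sum]].
have F2E : F2 = Phi t - F1 by rewrite Phi_sum addrC addKr.
have [c F1c] : exists c, F1 = c *: Phi t.
  by apply: summand_multiple; rewrite -?F2E.
move: freeF; rewrite F2E F1c -{2}[Phi t]scale1r -scalerBl.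
by rewrite (negbTE (free_multiples _ _ _)).
Qed.

(** Along the curve of the face (i,j) the linear coefficient in s of y^T B x is
    B_ii + B_jj, and divisibility by s^2 - t^2 of this quadratic polynomial makes
    it zero.  Three numbers with vanishing pairwise sums are zero. *)
Lemma bilinear_diag_eq0 t (B : 'M[R]_3) :
  (forall x y, ((y^T *m B *m x) 0 0) ^+ 2 <= choi_at t x y) -> B 0 0 = 0.
Proof.
move=> hB.
have face i j : (forall s, choi_at t (evec R i + s *: evec R j)
    (s *: evec R i + evec R j) = (s ^+ 2 - t ^+ 2) ^+ 2) -> B i i + B j j = 0.
  move=> hij.
  have [//|s|_] := @divisible_of_sqr_le R t 1 (B j i) (B i i + B j j) (B i j) 0.
    have := hB (evec R i + s *: evec R j) (s *: evec R i + evec R j).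
    rewrite hij [(_ + _)^T]linearD /= [(_ *: _)^T]linearZ /=.
    rewrite !mulmxDl !mulmxDr -!scalemxAl -!scalemxAr /evec !trmx_delta -!rowE -!colE.
    rewrite !mxE => h; apply: le_trans (_ : (s ^+ 2 - t ^+ 2) ^+ 2 <= _); last first.
      by have := sqr_ge0 s; have := sqr_ge0 (s ^+ 2 - t ^+ 2); nra.
    by apply: le_trans h; rewrite le_eqVlt; apply/orP; left; apply/eqP; ring.
  by rewrite mulr0 addr0.
have h01 : B 0 0 + B 1 1 = 0 by apply: face => s; have [] := choi_at_face t s.
have h12 : B 1 1 + B 2 2 = 0 by apply: face => s; have [] := choi_at_face t s.
have h20 : B 2 2 + B 0 0 = 0 by apply: face => s; have [] := choi_at_face t s.
lra.
Qed.

Lemma Phi_not_cp t : t ^+ 2 != 1 -> ~ completely_positive (Phi t).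
Proof.
move=> t1 [l [B hB]].
have sos x y : choi_at t x y = \sum_(i < l) ((y^T *m B i *m x) 0 0) ^+ 2.
  rewrite /choi_at -polar_Phi /polar symprod_outer hB mulmx_sumr mulmx_suml summxE.
  apply: eq_bigr => i _; rewrite mulmxA [_ *m (x *m x^T)]mulmxA mulmxA.
  rewrite -!mulmxA mulmxA mulmxA mxE big_ord1.
  rewrite expr2; congr (_ * _); first by rewrite mulmxA.
  by rewrite -[x^T *m _]trmxK mxE !trmx_mul !trmxK -mulmxA.
have diag0 i : B i 0 0 = 0.
  apply: (@bilinear_diag_eq0 t) => x y; rewrite sos (bigD1 i) //= lerDl.
  by apply: sumr_ge0 => j _; apply: sqr_ge0.
have := sos (evec R 0) (evec R 0).
rewrite big1 => [|i _]; last first.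
  by rewrite /evec trmx_delta -rowE -colE !mxE diag0 expr0n.
rewrite /choi_at !mxE /= => h.
have : (t ^+ 2 - 1) ^+ 2 = 0 by rewrite -h /choi_form; ring.
by move/eqP; rewrite sqrf_eq0 subr_eq0 (negbTE t1).
Qed.

End PhiMap.

Theorem theorem4 (R : realType) :
  (forall t : R, positive_map (Phi t)) /\
  (forall t : R, t <> 1 -> t <> -1 ->
     extremal (Phi t) /\ ~ completely_positive (Phi t)).
Proof.
split=> [t|t t1 tN1]; first exact: Phi_positive.
have t2 : t ^+ 2 != 1.
  by rewrite sqrf_eq1 negb_or; apply/andP; split; apply/eqP.
by split; [exact: Phi_extremal | exact: Phi_not_cp].
Qed.
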